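(* The Turing–Weihrauch lattice of partial multimaps on $\mathbf N$ (i.e. the poset of their Turing–Weihrauch degrees) is isomorphic to the poset of $r$-degrees of Lawvere–Tierney topologies $j\colon\Omega\to\Omega$ that preserve arbitrary (nonempty) intersections.
   Context: Let $(\mathsf N,\mathbf N,\ast)$ be one of: (i) Kleene's first algebra: $\mathsf N=\mathbf N=\mathbb N$, $e\ast n=\varphi_e(n)$ for the standard indexing of partial computable functions on $\mathbb N$; (ii) Kleene's second algebra: $\mathsf N=\mathbf N=\mathbb N^{\mathbb N}$, $x\ast y=\varphi_x(y)$ for the standard indexing $(\varphi_x)_{x\in\mathbb N^{\mathbb N}}$ of partial continuous functions on Baire space (e.g. $(x\ast y)(n)=x(\langle n,y(0),\dots,y(k-1)\rangle)-1$ for the least $k$ making $x(\cdots)>0$; $x\ast y$ is defined iff such $k$ exists for all $n$); (iii) the Kleene–Vesley algebra: $\mathbf N=\mathbb N^{\mathbb N}$ with $\ast$ as in (ii) and $\mathsf N$ the set of computable elements of $\mathbb N^{\mathbb N}$. Write $\varphi_x(y)=x\ast y$. A partial function on $\mathbf N$ is computable if for some $e\in\mathsf N$ it agrees with $\varphi_e$ on its domain. Pairs and finite sequences of elements of $\mathbf N$ are coded in $\mathbf N$ in a standard computable way. A partial multimap on $\mathbf N$ is a partial function $f$ from $\mathbf N$ to $\mathcal P(\mathbf N)$ (the value $\emptyset$ is allowed and is distinguished from being undefined). Turing–Weihrauch reducibility (also called generalized Weihrauch reducibility). For partial multimaps $f,g$, consider the perfect information game $\mathfrak G(f,g)$ between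 Oracle and Computer. Oracle first plays $z_0\in\mathrm{dom}(f)$. At round $n\ge 0$ Computer plays $\langle A_n,x_n\rangle$ with $A_n\in\{\mathtt{Query},\mathtt{Halt}\}$ and $x_n\in\mathbf N$. If $A_n=\mathtt{Query}$, the rules require $x_n\in\mathrm{dom}(g)$, and then Oracle must answer with some $z_{n+1}\in g(x_n)$; if $A_n=\mathtt{Halt}$ the game terminates. Computer wins if Oracle violates the rules before Computer does, or if Computer obeys the rules and at some round halts with $x_n\in f(z_0)$ (in particular an infinite rule-obeying play is not won by Computer). A strategy of Computer is a partial map $\tau$ from $\mathbf N^{<\omega}$ to $\{\mathtt{Query},\mathtt{Halt}\}\times\mathbf N$, giving $\langle A_n,x_n\rangle=\tau(z_0,\dots,z_n)$; being undefined counts as a rule violation. Oracle's moves are arbitrary. $\tau$ is winning if Computer wins every play following $\tau$. $f\leq_{TW}g$ iff Computer has a computable winning strategy in $\mathfrak G(f,g)$. $\Omega=\mathcal P(\mathbf N)$. For $p,q\in\Omega$, $p\to q=\{x\in\mathbf N: x\ast a\text{ is defined and }x\ast a\in q\text{ for all }a\in p\}$. An operation $j\colon\Omega\to\Omega$ is: monotone if some $e\in\mathsf N$ belongs to $(p\to q)\to(j(p)\to j(q))$ for all $p,q\in\Omega$; inflationary if some $e\in\mathsf N$ belongs to $p\to j(p)$ for all $p\in\Omega$; idempotent if some $e\in\mathsf N$ belongs to $j(j(p))\to j(p)$ for all $p\in\Omega$; a Lawvere–Tierney topology if it is monotone, inflationary and idempotent. It preserves arbitrary intersections if $j(\bigcap_{i\in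 I}p_i)=\bigcap_{i\in I}j(p_i)$ for every family with $I\ne\emptyset$. $j\leq_r k$ iff some $e\in\mathsf N$ belongs to $j(p)\to k(p)$ for all $p\in\Omega$. Degrees are equivalence classes of the preorder, with the induced partial order. *)

(* Defs.v *)
From Stdlib Require Cantor Relation_Definitions.
From mathcomp Require Import all_boot.
From mathcomp Require Import boolp classical_sets.

Set Implicit Arguments.
Unset Strict Implicit.
Unset Printing Implicit Defensive.

Local Open Scope classical_set_scope.

Definition npair (m n : nat) : nat := Cantor.to_nat (m, n).

(** Unary partial recursive functions, with several arguments packed by the
    Cantor pairing (written <a, b> below). *)
Inductive code : Type :=
| Zero
| Succ
| Fst
| Snd
| Pair of code & code
| Comp of code & code
| Prec of code & code
| Mu of code.

(** [eval c n m]: the function denoted by [c] is defined at [n], with value [m].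
    - [Prec c d] is h with  h <a, 0> = c a,  h <a, i+1> = d <a, <i, h <a, i>>>;
    - [Mu c] maps a to the least i such that c <a, i> = 0, provided that
      c <a, i'> is defined for all i' < i. *)
Fixpoint eval (c : code) : nat -> nat -> Prop :=
  match c with
  | Zero => fun _ m => m = 0
  | Succ => fun n m => m = n.+1
  | Fst => fun n m => m = (Cantor.of_nat n).1
  | Snd => fun n m => m = (Cantor.of_nat n).2
  | Pair c d => fun n m =>
      exists k l, [/\ eval c n k, eval d n l & m = npair k l]
  | Comp c d => fun n m => exists k, eval d n k /\ eval c k m
  | Prec c d => fun n m =>
      let: (a, k) := Cantor.of_nat n in
      (fix h (i : nat) : nat -> Prop :=
         match i with
         | 0 => eval c a
         | i'.+1 => fun m =>
             exists v, h i' v /\ eval d (npair a (npair i' v)) m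
         end) k m
  | Mu c => fun a m =>
      (forall i, i < m -> exists v, eval c (npair a i) v.+1)
      /\ eval c (npair a m) 0
  end.

Fixpoint index_of (c : code) : nat :=
  match c with
  | Zero => npair 0 0
  | Succ => npair 1 0
  | Fst => npair 2 0
  | Snd => npair 3 0
  | Pair c d => npair 4 (npair (index_of c) (index_of d))
  | Comp c d => npair 5 (npair (index_of c) (index_of d))
  | Prec c d => npair 6 (npair (index_of c) (index_of d))
  | Mu c => npair 7 (index_of c)
  end.

(** [phi e n m]: phi_e(n) is defined and equal to [m].  A number that is not the
    index of a code is an index of the nowhere defined function. *)
Definition phi (e n m : nat) : Prop := exists c, index_of c = e /\ eval c n m.

Lemma npair_inj m n m' n' : npair m n = npair m' n' -> m = m' /\ n = n'.
Proof. by move=> /Cantor.to_nat_inj [-> ->]. Qed.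

Lemma index_of_inj : injective index_of.
Proof.
elim=> [||||c IHc d IHd|c IHc d IHd|c IHc d IHd|c IHc]
  [||||c' d'|c' d'|c' d'|c'] //= /npair_inj [] // _.
- by move=> /npair_inj [/IHc-> /IHd->].
- by move=> /npair_inj [/IHc-> /IHd->].
- by move=> /npair_inj [/IHc-> /IHd->].
- by move=> /IHc->.
Qed.

Lemma eval_fun c n m m' : eval c n m -> eval c n m' -> m = m'.
Proof.
elim: c n m m' => [||||c IHc d IHd|c IHc d IHd|c IHc d IHd|c IHc] n m m' /=.
- by move=> -> ->.
- by move=> -> ->.
- by move=> -> ->.
- by move=> -> ->.
- by move=> [k [l [ck dl ->]]] [k' [l' [/(IHc _ _ _ ck)<- /(IHd _ _ _ dl)<- ->]]].
- by move=> [k [dk ckm]] [k' [/(IHd _ _ _ dk)<-]]; exact: IHc.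
- case: (Cantor.of_nat n) => a k.
  elim: k m m' => [|k IHk] m m'; first exact: IHc.
  by move=> [v [hv dm]] [v' [/(IHk _ _ hv)<-]]; exact: IHd.
- move=> [lt0 eq0] [lt0' eq0']; case: (ltngtP m m') => // lt_m.
  + by have [v /(IHc _ _ _ eq0)] := lt0' _ lt_m.
  + by have [v /(IHc _ _ _ eq0')] := lt0 _ lt_m.
Qed.

Lemma phi_fun e n m m' : phi e n m -> phi e n m' -> m = m'.
Proof. by move=> [c [<- cm]] [c' [/index_of_inj-> /(eval_fun cm)]]. Qed.

Definition baire : Type := nat -> nat.

Definition nseq_code (s : seq nat) : nat :=
  foldr (fun a c => (npair a c).+1) 0 s.

(** [baire_app x y z]: x * y is defined and equal to [z]; the [k] below is
    necessarily the least one with x <n, y 0, ..., y (k-1)> > 0. *)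
Definition baire_app (x y z : baire) : Prop :=
  forall n, exists k,
    (forall i, i < k -> x (nseq_code (n :: mkseq y i)) = 0)
    /\ x (nseq_code (n :: mkseq y k)) = (z n).+1.

Lemma baire_app_fun x y z z' : baire_app x y z -> baire_app x y z' -> z = z'.
Proof.
move=> xyz xyz'; apply: funext => n.
have [k [lt_k eq_k]] := xyz n; have [k' [lt_k' eq_k']] := xyz' n.
case: (ltngtP k k') => lt_kk'.
- by rewrite lt_k' in eq_k.
- by rewrite lt_k in eq_k'.
- by move: eq_k'; rewrite -lt_kk' eq_k => -[].
Qed.

Definition baire_pair (x y : baire) : baire :=
  fun n => if odd n then y n./2 else x n./2.

Definition baire_computable : set baire :=
  [set x | exists c, forall n, eval c n (x n)].

(** [app x y z] means that x * y is defined and equal to [z]; [comp] is the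
    set of computable elements; [pair] and [tag] serve to code pairs, finite
    sequences and moves of the Computer. *)
Record algebra : Type := Algebra {
  elt :> Type;
  comp : set elt;
  app : elt -> elt -> elt -> Prop;
  app_fun : forall x y z z', app x y z -> app x y z' -> z = z';
  pair : elt -> elt -> elt;
  tag : bool -> elt
}.

Inductive algebra_name := Kleene1 | Kleene2 | KleeneVesley.

Definition algebra_of (a : algebra_name) : algebra :=
  match a with
  | Kleene1 => Algebra [set: nat] phi_fun npair nat_of_bool
  | Kleene2 => Algebra [set: baire] baire_app_fun baire_pair (fun b _ => b : nat)
  | KleeneVesley =>
      Algebra baire_computable baire_app_fun baire_pair (fun b _ => b : nat)
  end.

Definition seq_code (N : algebra) (s : seq N) : N :=
  foldr (fun a c => pair (tag N true) (pair a c))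
        (pair (tag N false) (tag N false)) s.

(** [f x = None] means that [f] is undefined at [x], and [f x = Some set0] that
    it is defined there with empty value. *)
Definition multimap (N : algebra) : Type := N -> option (set N).

Definition mdom (N : algebra) (f : multimap N) : set N :=
  [set x | exists p, f x = Some p].

(** [mval f x y]: [x] is in the domain of [f] and [y] in f(x). *)
Definition mval (N : algebra) (f : multimap N) (x y : N) : Prop :=
  exists p, f x = Some p /\ p y.

Variant action := Query | Halt.

Definition strategy (N : algebra) : Type := seq N -> option (action * N).

Definition move_code (N : algebra) (m : action * N) : N :=
  pair (tag N (if m.1 is Halt then true else false)) m.2.

Definition computable_strategy (N : algebra) (tau : strategy N) : Prop :=
  exists e, comp e /\
    forall s m, tau s = Some m -> app e (seq_code s) (move_code m).

Section Game.
Context (N : algebra) (f g : multimap N) (tau : strategy N).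

(** The Oracle's moves form an arbitrary infinite sequence [z], whose entries
    after the end of the game are irrelevant. *)
Implicit Type z : nat -> N.

Definition computer_move z n : option (action * N) := tau (mkseq z n.+1).

Definition oracle_legal z n : Prop :=
  match n with
  | 0 => mdom f (z 0)
  | n'.+1 => exists x, computer_move z n' = Some (Query, x) /\ mval g x (z n)
  end.

Definition legal_query z n : Prop :=
  exists x, computer_move z n = Some (Query, x) /\ mdom g x.

Definition correct_halt z n : Prop :=
  exists x, computer_move z n = Some (Halt, x) /\ mval f (z 0) x.

(** Either the Oracle is the first to break the rules, at its move [z n], or
    nobody breaks them and the Computer halts correctly at round [n]. *)
Definition computer_wins z : Prop :=
  exists n, (forall m, m < n -> oracle_legal z m /\ legal_query z m)
    /\ (~ oracle_legal z n \/ (oracle_legal z n /\ correct_halt z n)).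

Definition winning : Prop := forall z, computer_wins z.

End Game.

Definition le_TW (N : algebra) (f g : multimap N) : Prop :=
  exists tau : strategy N, computable_strategy tau /\ winning f g tau.

Definition impl (N : algebra) (p q : set N) : set N :=
  [set x | forall a, p a -> exists b, app x a b /\ q b].

Section Operations.
Context (N : algebra).
Implicit Type j k : set N -> set N.

Definition monotone j : Prop :=
  exists e : N, comp e /\ forall p q, impl (impl p q) (impl (j p) (j q)) e.

Definition inflationary j : Prop :=
  exists e : N, comp e /\ forall p, impl p (j p) e.

Definition idempotent_op j : Prop :=
  exists e : N, comp e /\ forall p, impl (j (j p)) (j p) e.

Definition LT_topology j : Prop :=
  [/\ monotone j, inflationary j & idempotent_op j].

Definition preserves_intersections j : Prop :=
  forall (I : Type) (D : set I) (p : I -> set N), D !=set0 ->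
    j (\bigcap_(i in D) p i) = \bigcap_(i in D) j (p i).

Definition le_r j k : Prop :=
  exists e : N, comp e /\ forall p, impl (j p) (k p) e.

End Operations.

Definition cap_topology (N : algebra) : Type :=
  {j : set N -> set N | LT_topology j /\ preserves_intersections j}.

Definition le_cap (N : algebra) (j k : cap_topology N) : Prop :=
  le_r (sval j) (sval k).

Definition degree (T : Type) (R : T -> T -> Prop) : Type :=
  {C : set T | exists a, C = [set b | R a b /\ R b a]}.

Definition degree_le (T : Type) (R : T -> T -> Prop) (C D : degree R) : Prop :=
  exists a b, [/\ sval C a, sval D b & R a b].

Definition isomorphic_posets (A B : Type) (leA : A -> A -> Prop)
    (leB : B -> B -> Prop) : Prop :=
  [/\ Relation_Definitions.order A leA,
      Relation_Definitions.order B leB &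
      exists F : A -> B, bijective F /\ forall x y, leA x y <-> leB (F x) (F y)].

(* Main.v *)
(* To a multimap g one associates the operation J_g, where J_g(p) consists of the
   (coded) Computer strategies that, querying g, are sure to halt in p.  It is a
   Lawvere-Tierney topology, and it preserves nonempty intersections because a
   strategy determines its final answer from the answers of the Oracle.  For any
   topology j, recursion along a play shows that J_f <=_r j iff some computable
   function sends every x in dom f into j(f(x)); for j = J_g the latter is a
   winning strategy for the reduction f <=_TW g.  Conversely, an
   intersection-preserving topology j is equivalent to J_g for
   g(x) = \bigcap {p | x in j(p)}, since x in j(g(x)).

   These arguments only use that computable functions contain the basic
   combinators and are closed under composition, pairing and currying.  For
   Kleene's first algebra this rests on a universal code; for the other two, on
   computing values of x * y from finite parts of x and y. *)

From Stdlib Require Cantor Relation_Definitions.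
From mathcomp Require Import all_boot.
From mathcomp Require Import boolp classical_sets.
Require Import Defs.

Set Implicit Arguments.
Unset Strict Implicit.
Unset Printing Implicit Defensive.

Local Open Scope classical_set_scope.

(** * Recursive functions *)

Definition pi1 (n : nat) : nat := (Cantor.of_nat n).1.
Definition pi2 (n : nat) : nat := (Cantor.of_nat n).2.

Lemma pi1_npair m n : pi1 (npair m n) = m.
Proof. by rewrite /pi1 /npair Cantor.cancel_of_to. Qed.

Lemma pi2_npair m n : pi2 (npair m n) = n.
Proof. by rewrite /pi2 /npair Cantor.cancel_of_to. Qed.

Lemma npair_pi n : npair (pi1 n) (pi2 n) = n.
Proof. by rewrite /npair /pi1 /pi2 -surjective_pairing Cantor.cancel_to_of. Qed.

Definition npiE := (pi1_npair, pi2_npair).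

Opaque npair pi1 pi2.

Definition recursive (f : nat -> nat) : Prop := exists c, forall n, eval c n (f n).

Lemma eq_recursive f g : f =1 g -> recursive f -> recursive g.
Proof. by move=> fg [c fc]; exists c => n; rewrite -fg. Qed.

Lemma recursive_comp f g :
  recursive f -> recursive g -> recursive (fun n => f (g n)).
Proof. by move=> [c fc] [d gd]; exists (Comp c d) => n; exists (g n). Qed.

Lemma recursive_npair f g :
  recursive f -> recursive g -> recursive (fun n => npair (f n) (g n)).
Proof. by move=> [c fc] [d gd]; exists (Pair c d) => n; exists (f n), (g n). Qed.

Lemma recursive_pi1 f : recursive f -> recursive (fun n => pi1 (f n)).
Proof. by apply: recursive_comp; exists Fst. Qed.

Lemma recursive_pi2 f : recursive f -> recursive (fun n => pi2 (f n)).
Proof. by apply: recursive_comp; exists Snd. Qed.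

Lemma recursive_id : recursive id.
Proof.
apply: (eq_recursive npair_pi).
by apply: recursive_npair; [exists Fst | exists Snd].
Qed.

Lemma recursive_succ f : recursive f -> recursive (fun n => (f n).+1).
Proof. by apply: recursive_comp; exists Succ. Qed.

Lemma recursive_const k : recursive (fun=> k).
Proof. by elim: k => [|k IHk]; [exists Zero | apply: recursive_succ]. Qed.

Lemma recursive_nat_rec (a b : nat -> nat) (s : nat -> nat -> nat -> nat) :
  recursive a -> recursive b ->
  recursive (fun p => s (pi1 p) (pi1 (pi2 p)) (pi2 (pi2 p))) ->
  recursive (fun n => nat_rec (fun=> nat) (a n) (s n) (b n)).
Proof.
move=> [ca ac] rb [cs sc].
have rid := recursive_id.
(* [Prec] takes the parameter and the bound as one pair; [b] is restored by composing with the
   pairing of the identity and [b]. *)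
suff r : recursive (fun p => nat_rec (fun=> nat) (a (pi1 p)) (s (pi1 p)) (pi2 p)).
  have /= := recursive_comp r (recursive_npair rid rb).
  by apply: eq_recursive => n; rewrite !npiE.
exists (Prec ca cs) => p; rewrite -{1}[p]npair_pi /=.
rewrite [Cantor.of_nat _]Cantor.cancel_of_to.
elim: (pi2 p) => [|i IHi] /=; first exact: ac.
set v := nat_rec _ _ _ _ in IHi *.
by exists v; split=> //; have := sc (npair (pi1 p) (npair i v)); rewrite !npiE.
Qed.

Lemma recursive_iter (a b : nat -> nat) (s : nat -> nat -> nat) :
  recursive a -> recursive b -> recursive (fun p => s (pi1 p) (pi2 p)) ->
  recursive (fun n => iter (b n) (s n) (a n)).
Proof.
move=> ra rb rs.
apply: (@eq_recursive (fun n => nat_rec (fun=> nat) (a n) (fun i => s n) (b n))).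
  by move=> n; elim: (b n) => //= i ->.
apply: recursive_nat_rec => //.
have rid := recursive_id.
have /= := recursive_comp rs
  (recursive_npair (recursive_pi1 rid) (recursive_pi2 (recursive_pi2 rid))).
by apply: eq_recursive => p; rewrite !npiE.
Qed.

Ltac recursive_base := first
  [ assumption
  | exact: recursive_const
  | exact: recursive_id
  | apply: recursive_pi1
  | apply: recursive_pi2
  | apply: recursive_npair
  | apply: recursive_succ ].
Ltac recursive_step := recursive_base.
Ltac recursive_tac :=
  repeat (cbv beta; match goal with |- recursive _ => recursive_step end).

Lemma recursive_ifz f g h : recursive f -> recursive g -> recursive h ->
  recursive (fun n => if f n == 0 then g n else h n).
Proof.
move=> rf rg rh.
apply: (@eq_recursive (fun n => nat_rec (fun=> nat) (g n) (fun _ _ => h n) (f n))).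
  by move=> n; case: (f n).
apply: recursive_nat_rec => //.
by apply: (recursive_comp rh); recursive_tac.
Qed.

Lemma recursive_pred f : recursive f -> recursive (fun n => (f n).-1).
Proof.
move=> rf.
apply: (@eq_recursive (fun n => nat_rec (fun=> nat) 0 (fun i _ => i) (f n))).
  by move=> n; case: (f n).
by apply: recursive_nat_rec => //; recursive_tac.
Qed.

Lemma recursive_sub f g :
  recursive f -> recursive g -> recursive (fun n => f n - g n).
Proof.
move=> rf rg.
apply: (@eq_recursive (fun n => iter (g n) predn (f n))).
  by move=> n; rewrite iter_predn.
by apply: recursive_iter => //; apply: recursive_pred; recursive_tac.
Qed.

Lemma recursive_add f g :
  recursive f -> recursive g -> recursive (fun n => f n + g n).
Proof.
move=> rf rg.
apply: (@eq_recursive (fun n => iter (g n) succn (f n))).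
  by move=> n; rewrite iter_succn addnC.
by apply: recursive_iter => //; recursive_tac.
Qed.

Lemma recursive_ifeq f g h k :
  recursive f -> recursive g -> recursive h -> recursive k ->
  recursive (fun n => if f n == g n then h n else k n).
Proof.
move=> rf rg rh rk.
apply: (@eq_recursive (fun n => if (f n - g n) + (g n - f n) == 0 then h n else k n)).
  by move=> n; rewrite addn_eq0 !subn_eq0 -eqn_leq.
by apply: recursive_ifz => //; apply: recursive_add; apply: recursive_sub.
Qed.

Ltac recursive_arith := first
  [ recursive_base
  | apply: recursive_pred
  | apply: recursive_ifz
  | apply: recursive_ifeq
  | apply: recursive_sub
  | apply: recursive_add
  | match goal with H : recursive _ |- _ => apply: (recursive_comp H) end ].
Ltac recursive_step ::= recursive_arith.

(** * A universal code *)

(* A stack machine for [eval]: [ret v K] returns the value [v] to the stack [K] of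
   frames, and [ev e v K] is about to evaluate the code of index [e] at [v]. *)
Definition ret (v K : nat) : nat := npair 0 (npair v K).
Definition ev (e v K : nat) : nat := npair e.+1 (npair v K).
Definition push (t p K : nat) : nat := (npair (npair t p) K).+1.

Definition step_ev (e v K : nat) : nat :=
  let t := pi1 e in let u := pi2 e in
  if t == 0 then ret 0 K
  else if t == 1 then ret v.+1 K
  else if t == 2 then ret (pi1 v) K
  else if t == 3 then ret (pi2 v) K
  else if t == 4 then ev (pi1 u) v (push 0 (npair (pi2 u) v) K)
  else if t == 5 then ev (pi2 u) v (push 2 (pi1 u) K)
  else if t == 6 then
    ev (pi1 u) (pi1 v)
      (push 3 (npair (pi2 u) (npair (pi1 v) (npair 0 (pi2 v)))) K)
  else ev u (npair v 0) (push 4 (npair u (npair v 0)) K).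

(* The frames <tag, payload>, with the index of the code still to be run first:
   <0, <d, n>> and <1, v> for the two halves of [Pair], <2, c> for [Comp],
   <3, <d, <a, <i, k>>>> for stage i of k in [Prec], and <4, <c, <a, i>>> for the
   test of i in [Mu]. *)
Definition step_ret (v F K : nat) : nat :=
  let t := pi1 F in let c := pi1 (pi2 F) in let u := pi2 (pi2 F) in
  let a := pi1 u in let i := pi1 (pi2 u) in let k := pi2 (pi2 u) in
  if t == 0 then ev c u (push 1 v K)
  else if t == 1 then ret (npair (pi2 F) v) K
  else if t == 2 then ev (pi2 F) v K
  else if t == 3 then
    if i == k then ret v K
    else ev c (npair a (npair i v)) (push 3 (npair c (npair a (npair i.+1 k))) K)
  else
    if v == 0 then ret (pi2 u) K
    else ev c (npair a (pi2 u).+1) (push 4 (npair c (npair a (pi2 u).+1)) K).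

Definition step (s : nat) : nat :=
  let v := pi1 (pi2 s) in let K := pi2 (pi2 s) in
  if pi1 s == 0 then
    if K == 0 then s else step_ret v (pi1 K.-1) (pi2 K.-1)
  else step_ev (pi1 s).-1 v K.

Lemma recursive_step_fun : recursive step.
Proof. by rewrite /step /step_ev /step_ret /ev /ret /push; recursive_tac. Qed.

Definition steps (s s' : nat) : Prop := exists t, iter t step s = s'.

Lemma steps_trans s' s s'' : steps s s' -> steps s' s'' -> steps s s''.
Proof. by move=> [t <-] [u <-]; exists (u + t); rewrite iterD. Qed.

Lemma steps1 s : steps s (step s).
Proof. by exists 1. Qed.

Lemma stepl s s' : steps (step s) s' -> steps s s'.
Proof. exact: steps_trans (steps1 s). Qed.

(** The stack [K] is arbitrary so that the induction hypotheses apply under the frames pushed by the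
    enclosing code. Simulating convergent evaluations suffices, as realizers are constrained only on
    a domain. *)
Lemma steps_eval c n m K : eval c n m -> steps (ev (index_of c) n K) (ret m K).
Proof.
elim: c n m K => [||||c IHc d IHd|c IHc d IHd|c IHc d IHd|c IHc] n m K /=.
- by move=> ->; apply: stepl; rewrite /step /step_ev !npiE /=; exists 0.
- by move=> ->; apply: stepl; rewrite /step /step_ev !npiE /=; exists 0.
- by move=> ->; apply: stepl; rewrite /step /step_ev !npiE /=; exists 0.
- by move=> ->; apply: stepl; rewrite /step /step_ev !npiE /=; exists 0.
- move=> [k [l [ck dl ->]]].
  apply: stepl; rewrite /step /step_ev !npiE /=.
  apply: steps_trans (IHc _ _ _ ck) _.
  apply: stepl; rewrite /step /step_ret !npiE /=.
  apply: steps_trans (IHd _ _ _ dl) _.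
  by apply: stepl; rewrite /step /step_ret !npiE /=; exists 0.
- move=> [k [dk ck]].
  apply: stepl; rewrite /step /step_ev !npiE /=.
  apply: steps_trans (IHd _ _ _ dk) _.
  by apply: stepl; rewrite /step /step_ret !npiE /=; apply: IHc.
- rewrite -{1}[n]npair_pi [Cantor.of_nat _]Cantor.cancel_of_to.
  set h := (fix h (i : nat) : nat -> Prop := _).
  set a := pi1 n; set k := pi2 n => hm.
  apply: stepl; rewrite /step /step_ev !npiE /= -/a -/k.
  pose fr i := push 3 (npair (index_of d) (npair a (npair i k))) K.
  (* Loop invariant: the value of stage [i] is returned to the frame that records [i]. *)
  suff H i v : i <= k -> h i v ->
      steps (ev (index_of c) a (fr 0)) (ret v (fr i)).
    apply: (steps_trans (H k m (leqnn k) hm)).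
    by apply: stepl; rewrite /step /step_ret !npiE /= eqxx; exists 0.
  elim: i v => [|i IHi] v ik /=; first exact: IHc.
  move=> [w [hw dv]].
  apply: (steps_trans (IHi _ (ltnW ik) hw)).
  apply: stepl; rewrite /step /step_ret !npiE /= (ltn_eqF ik).
  exact: IHd.
- move=> [lt_m eq_m].
  apply: stepl; rewrite /step /step_ev !npiE /=.
  pose fr i := push 4 (npair (index_of c) (npair n i)) K.
  suff H i : i <= m ->
      steps (ev (index_of c) (npair n 0) (fr 0)) (ev (index_of c) (npair n i) (fr i)).
    apply: (steps_trans (H m (leqnn m))).
    apply: (steps_trans (IHc _ _ _ eq_m)).
    by apply: stepl; rewrite /step /step_ret !npiE /=; exists 0.
  elim: i => [|i IHi] im; first by exists 0.
  apply: (steps_trans (IHi (ltnW im))).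
  have [v cv] := lt_m _ im.
  apply: (steps_trans (IHc _ _ _ cv)).
  by apply: stepl; rewrite /step /step_ret !npiE /=; exists 0.
Qed.

Lemma eval_Mu c n m : (forall i, i < m -> exists v, eval c (npair n i) v.+1) ->
  eval c (npair n m) 0 -> eval (Mu c) n m.
Proof. by []. Qed.

(** [Mu] searches for the first time at which the stack machine has halted; the result is then read
    off its state. *)
Lemma universal_code :
  exists u, forall e n m, phi e n m -> eval u (npair e n) m.
Proof.
pose run p := iter (pi2 p) step (ev (pi1 (pi1 p)) (pi2 (pi1 p)) 0).
have rrun : recursive run.
  apply: (@recursive_iter (fun p => ev (pi1 (pi1 p)) (pi2 (pi1 p)) 0) pi2
    (fun _ => step)).
  - by rewrite /ev; recursive_tac.
  - exact: recursive_pi2 recursive_id.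
  - exact: recursive_comp recursive_step_fun (recursive_pi2 recursive_id).
have [c cE] : recursive (fun p => pi1 (run p) + pi2 (pi2 (run p))).
  by recursive_tac.
have [d dE] : recursive (fun p => pi1 (pi2 (run p))) by recursive_tac.
have [i iE] := recursive_id.
exists (Comp d (Pair i (Mu c))) => e n m [c' [<- c'm]].
have [t tE] := steps_eval 0 c'm.
(* The sum vanishes exactly when the machine is returning a value to the empty stack. *)
pose halted t := pi1 (run (npair (npair (index_of c') n) t))
  + pi2 (pi2 (run (npair (npair (index_of c') n) t))) == 0.
have run_t : run (npair (npair (index_of c') n) t) = ret m 0.
  by rewrite /run !npiE.
have ht : halted t by rewrite /halted run_t /ret !npiE.
case: (ex_minnP (ex_intro halted t ht)) => t0 ht0 min_t0.
pose x := npair (index_of c') n.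
exists (npair x t0); split.
  exists x, t0; split; [exact: iE| |by []].
  apply: eval_Mu => [j jt|].
    have : ~~ halted j by apply: contraL jt => /min_t0; rewrite -leqNgt.
    rewrite /halted; have := cE (npair x j).
    by case: (_ + _) => // v cv _; exists v.
  by have := cE (npair x t0); rewrite (eqP ht0).
(* The least halting time [t0] may precede [t], but a halted state is a fixed point of [step]. *)
suff run_t0 : run (npair x t0) = run (npair x t).
  by have := dE (npair x t0); rewrite run_t0 run_t /ret !npiE.
rewrite [RHS]/run !npiE -(subnK (min_t0 _ ht)) iterD.
have -> : iter t0 step (ev (index_of c') n 0) = run (npair x t0).
  by rewrite /run !npiE.
elim: (t - t0) => //= k <-; move: ht0.
by rewrite /halted addn_eq0 -/x => /andP[/eqP h1 /eqP h2]; rewrite /step h1 h2.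
Qed.

(** * Effective applicative structures *)

Definition tracked (N : algebra) (R : N -> N -> Prop) : Prop :=
  exists2 e, comp e & forall x y, R x y -> app e x y.

(** [eff_curry] is an s-m-n property: [clo x] exists for every [x], even where [e] diverges on all
    [pair x y]. *)
Record effective (N : algebra) : Prop := Effective {
  eff_id : @tracked N (fun x y => y = x);
  eff_const a : comp a -> @tracked N (fun _ y => y = a);
  eff_comp e f : comp e -> comp f ->
    @tracked N (fun x z => exists2 y, app f x y & app e y z);
  eff_pair e f : comp e -> comp f ->
    @tracked N (fun x p => exists y z, [/\ app e x y, app f x z & p = pair y z]);
  eff_fst : @tracked N (fun p x => exists y, p = pair x y);
  eff_snd : @tracked N (fun p y => exists x, p = pair x y);
  eff_cond : @tracked N (fun p z => exists (b : bool) x y,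
    p = pair (tag N b) (pair x y) /\ z = if b then x else y);
  eff_eval : @tracked N (fun p z => exists x y, p = pair x y /\ app x y z);
  eff_curry e : comp e -> exists clo : N -> N,
    tracked (fun x y => y = clo x) /\
    forall x y z, app e (pair x y) z -> app (clo x) y z;
  eff_tag b : comp (tag N b);
  eff_tagP : tag N true <> tag N false
}.

Lemma tracked_code (R : nat -> nat -> Prop) (c : code) :
  (forall x y, R x y -> eval c x y) -> @tracked (algebra_of Kleene1) R.
Proof. by move=> Rc; exists (index_of c) => // x y /Rc cxy; exists c. Qed.

Lemma tracked_recursive (R : nat -> nat -> Prop) (f : nat -> nat) :
  recursive f -> (forall x y, R x y -> y = f x) ->
  @tracked (algebra_of Kleene1) R.
Proof. by move=> [c fc] Rf; apply: (@tracked_code _ c) => x y /Rf ->. Qed.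

Definition const_index (x : nat) : nat :=
  iter x (fun e => npair 5 (npair (index_of Succ) e)) (index_of Zero).

Lemma const_index_code x :
  exists c, index_of c = const_index x /\ forall n, eval c n x.
Proof.
elim: x => [|x [c [cE cx]]]; first by exists Zero.
exists (Comp Succ c); split; last by move=> n; exists x.
by rewrite /const_index iterS -/(const_index x) -cE.
Qed.

Lemma kleene1_effective : effective (algebra_of Kleene1).
Proof.
have rid := recursive_id.
split=> //=.
- exact: tracked_recursive rid _.
- move=> a _; exact: tracked_recursive (recursive_const a) _.
(* Indices are assembled arithmetically because [e] and [f] need not be indices of codes; 5 is the
   tag of [Comp], and 4 below that of [Pair]. *)
- move=> e f _ _; exists (npair 5 (npair e f)) => // x z [y [d [<- dy]] [c [<- cz]]].
  by exists (Comp c d); split=> //; exists y.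
- move=> e f _ _; exists (npair 4 (npair e f)) => //.
  move=> x _ [y [z [[c [<- cy]] [d [<- dz]] ->]]].
  by exists (Pair c d); split=> //; exists y, z.
- apply: (tracked_recursive (recursive_pi1 rid)) => _ x [y ->].
  by rewrite npiE.
- apply: (tracked_recursive (recursive_pi2 rid)) => _ y [x ->].
  by rewrite npiE.
- have r : recursive (fun p => if pi1 p == 0 then pi2 (pi2 p) else pi1 (pi2 p)).
    by apply: recursive_ifz; recursive_tac.
  by apply: (tracked_recursive r) => _ z [[] [x [y [-> ->]]]]; rewrite !npiE.
- have [u uP] := universal_code.
  apply: (@tracked_code _ u) => _ z [x [y [-> xyz]]]; exact: uP.
- move=> e _; have [i iE] := rid.
  (* The s-m-n index: [e] composed with the pairing of the constant [x] and the identity. *)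
  exists (fun x => npair 5 (npair e (npair 4 (npair (const_index x) (index_of i))))).
  split=> [|x y z [c [<- cz]]].
    have r : recursive const_index.
      apply: (recursive_iter (s := fun _ e => npair 5 (npair (index_of Succ) e))) => //=;
      by recursive_tac.
    apply: (@tracked_recursive _ (fun x =>
      npair 5 (npair e (npair 4 (npair (const_index x) (index_of i)))))) => //.
    by recursive_tac.
  have [d [<- dx]] := const_index_code x.
  exists (Comp c (Pair d i)); split=> //; exists (npair x y); split=> //.
  by exists x, y.
Qed.

(** * Baire space *)

Lemma recursive_comp2 (a : nat -> nat -> nat) f g :
  recursive (fun p => a (pi1 p) (pi2 p)) -> recursive f -> recursive g ->
  recursive (fun n => a (f n) (g n)).
Proof.
move=> ra rf rg; have := recursive_comp ra (recursive_npair rf rg).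
by apply: eq_recursive => n; rewrite !npiE.
Qed.

Lemma recursive_ifodd f g h : recursive f -> recursive g -> recursive h ->
  recursive (fun n => if odd (f n) then g n else h n).
Proof.
move=> rf rg rh.
apply: (@eq_recursive (fun n => if iter (f n) (fun b => 1 - b) 0 == 0 then h n else g n)).
  move=> n; have -> : iter (f n) (fun b => 1 - b) 0 = odd (f n).
    by elim: (f n) => //= i ->; case: odd.
  by case: odd.
apply: recursive_ifz => //; apply: recursive_iter => //; by recursive_tac.
Qed.

Lemma recursive_half f : recursive f -> recursive (fun n => (f n)./2).
Proof.
move=> rf.
apply: (@eq_recursive (fun n =>
  nat_rec (fun=> nat) 0 (fun i v => if odd i then v.+1 else v) (f n))).
  by move=> n; elim: (f n) => //= i ->; rewrite uphalf_half; case: odd.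
apply: recursive_nat_rec => //; first exact: recursive_const.
by apply: recursive_ifodd; recursive_tac.
Qed.

Lemma recursive_double f : recursive f -> recursive (fun n => (f n).*2).
Proof.
move=> rf; apply: (@eq_recursive (fun n => f n + f n)).
  by move=> n; rewrite addnn.
by recursive_tac.
Qed.

Lemma recursive_nseq_code (h : nat -> nat -> nat) k :
  recursive (fun p => h (pi1 p) (pi2 p)) -> recursive k ->
  recursive (fun n => nseq_code (mkseq (h n) (k n))).
Proof.
move=> rh rk.
apply: (@eq_recursive (fun n => nat_rec (fun=> nat) 0
  (fun i c => (npair (h n (k n - i.+1)) c).+1) (k n))).
  move=> n; rewrite /mkseq.
  (* The code is built from the end: after [j] stages it holds the last [j] entries. *)
  suff H j : j <= k n -> nat_rec (fun=> nat) 0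
      (fun i c => (npair (h n (k n - i.+1)) c).+1) j =
      nseq_code (map (h n) (iota (k n - j) j)) by rewrite H // subnn.
  by elim: j => //= j IHj jk; rewrite IHj 1?ltnW // -subSn // subSS.
apply: recursive_nat_rec => //; first exact: recursive_const.
apply: recursive_succ; apply: recursive_npair; last by recursive_tac.
by apply: (recursive_comp2 rh); recursive_tac.
Qed.

(* Partial functions on [nat] are represented by total ones, with values [0] for
   undefined and [v.+1] for [v]. *)
Definition approximates (h y : nat -> nat) : Prop :=
  forall j, h j = 0 \/ h j = (y j).+1.

Definition behead_code (c : nat) : nat := if c == 0 then 0 else pi2 c.-1.

Definition look (c i : nat) : nat :=
  let d := iter i behead_code c in if d == 0 then 0 else (pi1 d.-1).+1.

Lemma look_nseq_code s i :
  look (nseq_code s) i = if i < size s then (nth 0 s i).+1 else 0.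
Proof.
rewrite /look; elim: i s => [|i IHi] [|x s] //=; rewrite ?npiE //.
  by have /= := IHi [::]; rewrite -iterS iterSr.
by rewrite -iterS iterSr {2 4}/behead_code /= npiE IHi.
Qed.

Lemma look_mkseq y k i :
  look (nseq_code (mkseq y k)) i = if i < k then (y i).+1 else 0.
Proof. by rewrite look_nseq_code size_mkseq; case: ltnP => // ik; rewrite nth_mkseq. Qed.

Lemma look_approximates y k : approximates (look (nseq_code (mkseq y k))) y.
Proof. by move=> j; rewrite look_mkseq; case: ifP; [right | left]. Qed.

Lemma recursive_look f g :
  recursive f -> recursive g -> recursive (fun n => look (f n) (g n)).
Proof.
move=> rf rg.
have r : recursive (fun n => iter (g n) behead_code (f n)).
  by apply: recursive_iter => //; apply: recursive_ifz; recursive_tac.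
by apply: recursive_ifz; recursive_tac.
Qed.

Lemma leq_npair m n : n <= npair m n.
Proof.
have /leP := Cantor.to_nat_non_decreasing m n.
by rewrite -[Cantor.to_nat _]/(npair m n) plusE; apply: leq_trans; rewrite leq_addr.
Qed.

Lemma leq_size_nseq_code s : size s <= nseq_code s.
Proof. by elim: s => //= x s IHs; apply: leq_trans IHs (leq_npair _ _). Qed.

(** * Application evaluated on finite approximations *)

Definition defined (h : nat -> nat) (i : nat) : bool :=
  all (fun j => h j != 0) (iota 0 i).

Lemma definedP h i : reflect (forall j, j < i -> h j != 0) (defined h i).
Proof.
apply: (iffP allP) => H j; first by move=> ji; apply: H; rewrite mem_iota.
by rewrite mem_iota => /H.
Qed.

Lemma definedS h i : defined h i.+1 = defined h i && (h i != 0).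
Proof. by rewrite /defined -[i.+1]addn1 iotaD all_cat /= andbT. Qed.

Lemma recursive_defined (h : nat -> nat -> nat) i f g :
  recursive (fun p => h (pi1 p) (pi2 p)) -> recursive i ->
  recursive f -> recursive g ->
  recursive (fun n => if defined (h n) (i n) then f n else g n).
Proof.
move=> rh ri rf rg.
apply: (@eq_recursive (fun n => if nat_rec (fun=> nat) 1
   (fun j v => if h n j == 0 then 0 else v) (i n) == 0 then g n else f n)).
  move=> n; suff -> : nat_rec (fun=> nat) 1
     (fun j v => if h n j == 0 then 0 else v) (i n) = defined (h n) (i n).
    by case: defined.
  by elim: (i n) => //= j ->; rewrite definedS; case: (h n j) => [|?] /=;
    rewrite ?andbF ?andbT.
apply: recursive_ifz => //; apply: recursive_nat_rec => //.
  exact: recursive_const.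
apply: recursive_ifz; recursive_tac.
by apply: (recursive_comp2 rh); recursive_tac.
Qed.

(** A bounded search: the first value other than 1 at an argument up to [m], or 1 if there is
    none. *)
Definition first_neq1 (F : nat -> nat) (m : nat) : nat :=
  nat_rec (fun=> nat) (F 0) (fun i v => if v == 1 then F i.+1 else v) m.

Lemma first_neq1_all F m : (forall i, i <= m -> F i = 1) -> first_neq1 F m = 1.
Proof.
rewrite /first_neq1; elim: m => [|m IHm] H /=; first exact: H.
by rewrite IHm ?H // => i im; apply/H/leqW.
Qed.

Lemma first_neq1_first F m i : i <= m -> (forall j, j < i -> F j = 1) ->
  F i <> 1 -> first_neq1 F m = F i.
Proof.
move=> im F1 Fi; elim: m im => [|m IHm]; first by rewrite leqn0 => /eqP->.
rewrite leq_eqVlt => /predU1P[im|im].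
  rewrite {1}im /first_neq1 /= -/(first_neq1 F m) first_neq1_all // => j jm.
  by apply: F1; rewrite im.
by rewrite /first_neq1 /= -/(first_neq1 F m) IHm //; case: eqP Fi.
Qed.

Definition attempt (a h : nat -> nat) (n i : nat) : nat :=
  if defined h i then a (nseq_code (n :: mkseq (fun j => (h j).-1) i)) else 0.

(* The value at [n] of the application of [a] to [h], as far as it is determined
   by the first [m] values of [h].  A value [1] of [attempt] stands for a defined
   value 0 of [a], which means that a longer prefix of [h] is to be tried. *)
Definition papp (a h : nat -> nat) (m n : nat) : nat :=
  (first_neq1 (attempt a h n) m).-1.

(** Up to the true length [k], an attempt is either undefined or the successor of the true entry of
    [A], and that entry is 0 before [k]. Hence the first attempt other than 1 is undefined or occurs
    at [k]. The final predecessor turns both 0 and 1 into undefined. *)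
Lemma papp_approximates a h A y z m : approximates a A -> approximates h y ->
  baire_app A y z -> approximates (papp a h m) z.
Proof.
move=> aA hy Ayz n; have [k [lt_k eq_k]] := Ayz n.
have att i : i <= k -> attempt a h n i = 0 \/
    attempt a h n i = (A (nseq_code (n :: mkseq y i))).+1.
  move=> ik; rewrite /attempt; case: definedP => [hi|_]; last by left.
  have -> : mkseq (fun j => (h j).-1) i = mkseq y i; last exact: aA.
  apply/eq_in_map => j; rewrite mem_iota => /hi.
  by case: (hy j) => ->.
have ex : exists i, attempt a h n i != 1.
  by exists k; case: (att k (leqnn k)) => ->; rewrite ?eq_k.
case: (ex_minnP ex) => i /eqP i1 min_i.
have ik : i <= k.
  by apply: min_i; case: (att k (leqnn k)) => ->; rewrite ?eq_k.
have lt_i j : j < i -> attempt a h n j = 1.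
  move=> ji; apply/eqP; apply: contraLR ji => /min_i.
  by rewrite -leqNgt.
rewrite /papp; case: (leqP i m) => im.
  rewrite (@first_neq1_first _ _ i) //.
  case: (att i ik) => E; first by left; rewrite E.
  move: i1; rewrite E; move: ik; rewrite leq_eqVlt => /predU1P[->|ik].
    by rewrite eq_k; right.
  by rewrite lt_k.
by left; rewrite first_neq1_all // => j jm; apply: lt_i; apply: leq_ltn_trans im.
Qed.

Lemma papp_modulus A y z n : baire_app A y z -> exists K, forall a h m,
  K <= m -> (forall j, j < K -> h j = (y j).+1) ->
  (forall j, j < K -> a j = (A j).+1) -> papp a h m n = (z n).+1.
Proof.
move=> /(_ n) [k [lt_k eq_k]].
(* [A] is consulted at the codes of prefixes of length at most [k], and [K] exceeds all of them. *)
pose K := \max_(i < k.+1) (nseq_code (n :: mkseq y i)).+1.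
exists (maxn k K) => a h m; rewrite geq_max => /andP[km _] hK aK.
have att i : i <= k ->
    attempt a h n i = (A (nseq_code (n :: mkseq y i))).+1.
  move=> ik.
  have hi j : j < i -> h j = (y j).+1.
    by move=> ji; apply: hK; rewrite leq_max (leq_trans ji ik).
  rewrite /attempt; case: definedP => [_|[]]; last by move=> j /hi ->.
  have -> : mkseq (fun j => (h j).-1) i = mkseq y i.
    by apply/eq_in_map => j; rewrite mem_iota => /hi ->.
  apply: aK; rewrite leq_max; apply/orP; right.
  pose F (i : 'I_k.+1) := (nseq_code (n :: mkseq y i)).+1.
  exact: (@leq_bigmax _ F (Ordinal (n := k.+1) (m := i) ik)).
rewrite /papp (@first_neq1_first _ _ k) ?att ?eq_k //.
by move=> j jk; rewrite att ?lt_k // ltnW.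
Qed.

(** Attempts up to [m] read [h] only below [m]. This makes each entry of a closure depend on a
    finite part of its parameter. *)
Lemma eq_papp a h h' m n :
  (forall j, j < m -> h j = h' j) -> papp a h m n = papp a h' m n.
Proof.
move=> hh'; rewrite /papp; congr _.-1.
have att i : i <= m -> attempt a h n i = attempt a h' n i.
  move=> im; rewrite /attempt /defined.
  have -> : all (fun j => h j != 0) (iota 0 i) = all (fun j => h' j != 0) (iota 0 i).
    apply: eq_in_all => j; rewrite mem_iota => /= ji.
    by rewrite hh' // (leq_trans ji im).
  have -> // : mkseq (fun j => (h j).-1) i = mkseq (fun j => (h' j).-1) i.
  by apply/eq_in_map => j; rewrite mem_iota => /= ji; rewrite hh' // (leq_trans ji im).
rewrite /first_neq1; elim: m {hh'} att => [|m IHm] att /=; first exact: att.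
by rewrite IHm ?att // => i im; apply: att; apply: leqW.
Qed.

Lemma recursive_papp (a h : nat -> nat -> nat) m n :
  recursive (fun p => a (pi1 p) (pi2 p)) -> recursive (fun p => h (pi1 p) (pi2 p)) ->
  recursive m -> recursive n ->
  recursive (fun x => papp (a x) (h x) (m x) (n x)).
Proof.
move=> ra rh rm rn; apply: recursive_pred.
have rat f g : recursive f -> recursive g ->
    recursive (fun x => attempt (a (f x)) (h (f x)) (n (f x)) (g x)).
  move=> rf rg.
  apply: (@recursive_defined (fun x => h (f x))) => //.
  - by apply: (recursive_comp2 rh); recursive_tac.
  - apply: (recursive_comp2 ra) => //=; apply: recursive_succ; apply: recursive_npair.
      exact: recursive_comp rn rf.
    apply: (@recursive_nseq_code (fun x j => (h (f x) j).-1)) => //.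
    by apply: recursive_pred; apply: (recursive_comp2 rh); recursive_tac.
  - exact: recursive_const.
apply: (@recursive_nat_rec (fun x => attempt (a x) (h x) (n x) 0) m
  (fun x i v => if v == 1 then attempt (a x) (h x) (n x) i.+1 else v)) => //.
- by apply: rat; recursive_tac.
- by apply: recursive_ifeq; recursive_tac; apply: rat; recursive_tac.
Qed.

Ltac recursive_step ::= first
  [ apply: recursive_look
  | apply: recursive_ifodd
  | apply: recursive_half
  | apply: recursive_double
  | recursive_arith ].

(* The element of Baire space whose entry at <n, s> is [G n s], where [s] is
    given by its code. *)
Definition assoc (G : nat -> nat -> nat) : baire :=
  fun c => G (pi1 c.-1) (behead_code c).

Lemma assocE G n s : assoc G (nseq_code (n :: s)) = G n (nseq_code s).
Proof. by rewrite /assoc /behead_code /= !npiE. Qed.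

Lemma recursive_assoc G :
  recursive (fun p => G (pi1 p) (pi2 p)) -> recursive (assoc G).
Proof.
by move=> rG; apply: (recursive_comp2 rG); rewrite ?/behead_code; recursive_tac.
Qed.

(** Every nonzero value of [G] is already correct, so the shortest prefix with a nonzero value is
    the one required by [baire_app]. *)
Lemma assoc_app G (y z : baire) :
  (forall k, approximates (fun n => G n (nseq_code (mkseq y k))) z) ->
  (forall n, exists k, G n (nseq_code (mkseq y k)) = (z n).+1) ->
  baire_app (assoc G) y z.
Proof.
move=> appr tot n.
have ex : exists k, G n (nseq_code (mkseq y k)) != 0.
  by have [k E] := tot n; exists k; rewrite E.
case: (ex_minnP ex) => k k0 min_k; exists k; rewrite assocE; split.
  move=> i; rewrite assocE; apply: contraTeq => /min_k.
  by rewrite leqNgt.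
by case: (appr k n) k0 => ->.
Qed.

(** Allows the code of a prefix to serve as the search bound in [papp]. *)
Lemma leq_prefix_code y k : k <= nseq_code (mkseq y k).
Proof. by rewrite -{1}(size_mkseq y k) leq_size_nseq_code. Qed.

Lemma approximates_succ y : approximates (fun i => (y i).+1) y.
Proof. by move=> i; right. Qed.

Lemma leq_half n : n./2 <= n.
Proof. by rewrite leq_half_double -addnn leqW ?leq_addr. Qed.

(** * Associates of the basic operations *)

Definition id_assoc : baire := assoc (fun n c => look c n).

Lemma id_app y : baire_app id_assoc y y.
Proof.
apply: assoc_app => [k n|n]; first exact: look_approximates.
by exists n.+1; rewrite look_mkseq ltnSn.
Qed.

Definition look_at (p : nat -> nat) : baire := assoc (fun n c => look c (p n)).

Lemma look_at_app p y : baire_app (look_at p) y (fun n => y (p n)).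
Proof.
apply: assoc_app => [k n|n]; first exact: look_approximates.
by exists (p n).+1; rewrite look_mkseq ltnSn.
Qed.

Definition const_assoc (a : baire) : baire := assoc (fun n _ => (a n).+1).

Lemma const_app a y : baire_app (const_assoc a) y a.
Proof. by apply: assoc_app => [k n|n]; [right | exists 0]. Qed.

Definition comp_assoc (x y : baire) : baire := assoc (fun n c =>
  papp (fun i => (x i).+1) (papp (fun i => (y i).+1) (look c) c) c n).

Lemma comp_app x y a b d :
  baire_app y a b -> baire_app x b d -> baire_app (comp_assoc x y) a d.
Proof.
move=> yab xbd; apply: assoc_app => [k|n].
  apply: papp_approximates (@approximates_succ x) _ xbd.
  apply: papp_approximates (@approximates_succ y) _ yab.
  exact: look_approximates.
have [K KP] := papp_modulus n xbd.
have [L LP] := choice (fun j => papp_modulus j yab).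
(* The result at [n] needs [K] entries of the intermediate value, and its entry [j] needs [L j]
   entries of [a]. *)
pose k := maxn K (\max_(j < K) L j).
have kc := leq_prefix_code a k.
exists k; apply: KP => //; first by apply: leq_trans kc; apply: leq_maxl.
move=> j jK.
have Lk : L j <= k.
  by rewrite leq_max (@leq_bigmax _ (fun i : 'I_K => L i) (Ordinal jK)) orbT.
apply: LP => //; first exact: leq_trans kc.
by move=> i iL; rewrite look_mkseq (leq_trans iL Lk).
Qed.

(** If [c] codes [s], then [(npair n./2 c).+1] codes [n./2 :: s]: each request is passed on with the
    same prefix, so the least lengths agree. *)
Definition pair_assoc (x y : baire) : baire := assoc (fun n c =>
  if odd n then y (npair n./2 c).+1 else x (npair n./2 c).+1).

Lemma pair_app x y a b d : baire_app x a b -> baire_app y a d ->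
  baire_app (pair_assoc x y) a (baire_pair b d).
Proof.
move=> xab yad n; rewrite /baire_pair.
case E: (odd n).
  have [k [lt_k eq_k]] := yad n./2; exists k.
  by split=> [i ik|]; rewrite /pair_assoc assocE E; [apply: lt_k | apply: eq_k].
have [k [lt_k eq_k]] := xab n./2; exists k.
by split=> [i ik|]; rewrite /pair_assoc assocE E; [apply: lt_k | apply: eq_k].
Qed.

Lemma baire_pair_double x y n : baire_pair x y n.*2 = x n.
Proof. by rewrite /baire_pair odd_double doubleK. Qed.

Lemma baire_pair_doubleS x y n : baire_pair x y n.*2.+1 = y n.
Proof. by rewrite /baire_pair /= odd_double uphalf_double. Qed.

Definition eval_assoc : baire := assoc (fun n c =>
  papp (fun j => look c j.*2) (fun j => look c j.*2.+1) c n).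

Lemma eval_app x y z : baire_app x y z -> baire_app eval_assoc (baire_pair x y) z.
Proof.
move=> xyz; apply: assoc_app => [k|n].
  apply: papp_approximates xyz => j.
    by rewrite -(baire_pair_double x y j); apply: look_approximates.
  by rewrite -(baire_pair_doubleS x y j); apply: look_approximates.
have [K KP] := papp_modulus n xyz.
have lt2 j : j < K -> j.*2.+1 < K.*2 by rewrite -doubleS leq_double.
(* The first [K] entries of both components lie among the first [K.*2] entries of the pair. *)
exists K.*2; apply: KP => [|j jK|j jK].
- by apply: leq_trans (leq_prefix_code _ _); rewrite -addnn leq_addr.
- by rewrite look_mkseq lt2 // baire_pair_doubleS.
- by rewrite look_mkseq ltnW ?lt2 // baire_pair_double.
Qed.

(** Since [look] adds one, the value 1 at entry 0 is the tag [false]. In the nested pair, [x]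
    occupies the entries 4n+1 and [y] the entries 4n+3. *)
Definition cond_assoc : baire := assoc (fun n c =>
  if look c 0 == 0 then 0
  else if look c 0 == 1 then look c n.*2.+1.*2.+1 else look c n.*2.*2.+1).

Lemma cond_app (b : bool) x y :
  baire_app cond_assoc (baire_pair (fun=> b : nat) (baire_pair x y))
    (if b then x else y).
Proof.
set p := baire_pair _ _.
have p0 : p 0 = b by [].
have px n : p n.*2.*2.+1 = x n.
  by rewrite /p baire_pair_doubleS baire_pair_double.
have py n : p n.*2.+1.*2.+1 = y n by rewrite /p !baire_pair_doubleS.
apply: assoc_app => [k n|n].
  rewrite [look _ 0]look_mkseq p0; case: (ltnP 0 k) => _; last by left.
  by case: b {p0} @p px py => /= px py; rewrite -?px -?py; apply: look_approximates.
exists n.*2.+1.*2.+2; rewrite !look_mkseq p0 px py ltnSn.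
have -> : n.*2.*2.+1 < n.*2.+1.*2.+2 by rewrite doubleS !ltnS; do 2 apply: leqW.
by case: (b).
Qed.

Definition closure (x a : baire) : baire := assoc (fun n c =>
  papp (fun i => (x i).+1)
    (fun j => if odd j then look c j./2 else (a j./2).+1) c n).

Lemma closure_app x a y z :
  baire_app x (baire_pair a y) z -> baire_app (closure x a) y z.
Proof.
move=> xz; apply: assoc_app => [k|n].
  apply: papp_approximates (@approximates_succ x) _ xz.
  move=> j; rewrite /baire_pair; case: odd; last by right.
  exact: look_approximates.
have [K KP] := papp_modulus n xz.
exists K; apply: KP => //; first exact: leq_prefix_code.
move=> j jK; rewrite /baire_pair; case: odd => //.
by rewrite look_mkseq (leq_ltn_trans (leq_half j) jK).
Qed.

(** An entry of [closure x a] is a bounded, total computation reading [a] only below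
    [behead_code p]. Once that part of [a] is known, the entry is output; the outer successor marks
    it as known even if it is 0. *)
Definition curry_assoc (x : baire) : baire := assoc (fun p d =>
  let c := behead_code p in
  if defined (look d) c then
    (papp (fun i => (x i).+1)
      (fun j => if odd j then look c j./2 else look d j./2) c (pi1 p.-1)).+1
  else 0).

Lemma curry_app x a : baire_app (curry_assoc x) a (closure x a).
Proof.
apply: assoc_app => [k p|p].
  rewrite /=; case: definedP => [def|_]; [right | by left].
  congr _.+1; rewrite /closure /assoc; apply: eq_papp => j jc; case: odd => //.
  have lt_j : j./2 < behead_code p.
    by apply: leq_ltn_trans jc; exact: leq_half.
  by move: (def _ lt_j); rewrite look_mkseq; case: ltnP.
exists (behead_code p) => /=; case: definedP => [_|[]];
  last by move=> j jc; rewrite look_mkseq jc.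
congr _.+1; rewrite /closure /assoc; apply: eq_papp => j jc; case: odd => //.
by rewrite look_mkseq (leq_ltn_trans (leq_half j) jc).
Qed.

(** Both algebras on Baire space are treated at once: the associates are recursive, or recursive in
    recursive arguments, so [P] is closed under the constructions in either case. *)
Lemma baire_effective (P : set baire) :
  P = setT \/ P = baire_computable ->
  effective (Algebra P baire_app_fun baire_pair (fun b _ => b : nat)).
Proof.
move=> PT.
have P0 x : recursive x -> P x by case: PT => -> // [c cx]; exists c.
have P1 (F : baire -> baire) :
    (forall x, recursive x -> recursive (F x)) -> forall x, P x -> P (F x).
  by case: PT => -> // FP x Px; apply: FP.
have P2 (F : baire -> baire -> baire) :
    (forall x y, recursive x -> recursive y -> recursive (F x y)) ->
    forall x y, P x -> P y -> P (F x y).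
  by case: PT => -> // FP x y Px Py; apply: FP.
split=> //=.
- exists id_assoc; last by move=> x _ ->; exact: id_app.
  apply: P0; apply: recursive_assoc; recursive_tac.
- move=> a Pa; exists (const_assoc a) => [|x _ ->]; last exact: const_app.
  apply: P1 a Pa => a ra; apply: recursive_assoc.
  by recursive_tac.
- move=> x y Px Py; exists (comp_assoc x y) => [|a d [b]]; last exact: comp_app.
  apply: P2 x y Px Py => x y rx ry; apply: recursive_assoc.
  apply: (@recursive_papp (fun _ i => (x i).+1)
    (fun p => papp (fun i => (y i).+1) (look (pi2 p)) (pi2 p)));
    [by recursive_tac| |by recursive_tac|by recursive_tac].
  by apply: (@recursive_papp (fun _ i => (y i).+1) (fun p => look (pi2 (pi1 p))));
    recursive_tac.
- move=> x y Px Py; exists (pair_assoc x y) => [|a _ [b [d [xb yd ->]]]].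
    apply: P2 x y Px Py => x y rx ry; apply: recursive_assoc.
    by recursive_tac.
  exact: pair_app.
- exists (look_at double) => [|_ x [y ->]].
    by apply: P0; apply: recursive_assoc; recursive_tac.
  have := look_at_app double (baire_pair x y).
  by congr baire_app; apply: funext => n; rewrite baire_pair_double.
- exists (look_at (fun n => n.*2.+1)) => [|_ y [x ->]].
    by apply: P0; apply: recursive_assoc; recursive_tac.
  have := look_at_app (fun n => n.*2.+1) (baire_pair x y).
  by congr baire_app; apply: funext => n; rewrite baire_pair_doubleS.
- exists cond_assoc => [|_ _ [b [x [y [-> ->]]]]]; last exact: cond_app.
  apply: P0; apply: recursive_assoc.
  by recursive_tac.
- exists eval_assoc => [|_ z [x [y [-> xyz]]]]; last exact: eval_app.
  apply: P0; apply: recursive_assoc.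
  apply: (@recursive_papp (fun p j => look (pi2 p) j.*2)
    (fun p j => look (pi2 p) j.*2.+1)); by recursive_tac.
- move=> x Px; exists (closure x); split; last exact: closure_app.
  exists (curry_assoc x) => [|a _ ->]; last exact: curry_app.
  apply: P1 x Px => x rx; apply: recursive_assoc.
  have rb f : recursive f -> recursive (fun n => behead_code (f n)).
    by move=> rf; apply: recursive_ifz; recursive_tac.
  apply: (@recursive_defined (fun p => look (pi2 p))).
  - by recursive_tac.
  - by apply: rb; recursive_tac.
  - apply: recursive_succ.
    apply: (@recursive_papp (fun _ i => (x i).+1)
      (fun p j => if odd j then look (behead_code (pi1 p)) j./2
                  else look (pi2 p) j./2)).
    + by recursive_tac.
    + by recursive_tac; apply: rb; recursive_tac.
    + by apply: rb; recursive_tac.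
    + by recursive_tac.
  - by recursive_tac.
- by move=> b; apply: P0; apply: recursive_const.
- by move/(congr1 (fun f : baire => f 0)).
Qed.

Lemma algebra_effective a : effective (algebra_of a).
Proof.
case: a; first exact: kleene1_effective.
- by apply: baire_effective; left.
- by apply: baire_effective; right.
Qed.

(** * Terms and their realizers *)

Section Terms.
Context (N : algebra) (NE : effective N).

(** Injectivity comes from the realizers of the projections, as application is single-valued. *)
Lemma pair_inj (x y x' y' : N) : pair x y = pair x' y' -> x = x' /\ y = y'.
Proof.
move=> E; have [e _ eP] := eff_fst NE; have [f _ fP] := eff_snd NE.
split.
  apply: (@app_fun _ e (pair x y)); first by apply: eP; exists y.
  by rewrite E; apply: eP; exists y'.
apply: (@app_fun _ f (pair x y)); first by apply: fP; exists x.
by rewrite E; apply: fP; exists x'.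
Qed.

Lemma tag_inj : injective (tag N).
Proof. by case=> -[] // E; case: (eff_tagP NE). Qed.

Definition computable_elt : Type := {e : N | comp e}.

Definition realizer (R : N -> N -> Prop) (h : tracked R) : computable_elt :=
  exist _ (s2val (cid2 h)) (s2valP (cid2 h)).

Lemma realizerP R (h : tracked R) x y : R x y -> app (sval (realizer h)) x y.
Proof. exact: (s2valP' (cid2 h)). Qed.

(** [If] is strict in both branches, so branches that may diverge have to be delayed by [Lam].
    [Closed] discards the environment, so that a recursive function denotes the same element
    wherever it occurs. *)
Inductive term : Type :=
| Var of nat
| Cst of computable_elt
| App of term & term
| Pr of term & term
| Fs of term
| Sn of term
| If of term & term & term
| Lam of term
| Closed of term.

Definition compose (e f : computable_elt) : computable_elt :=
  realizer (eff_comp NE (svalP e) (svalP f)).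
Definition pairing (e f : computable_elt) : computable_elt :=
  realizer (eff_pair NE (svalP e) (svalP f)).

Lemma composeP e f x y z :
  app (sval f) x y -> app (sval e) y z -> app (sval (compose e f)) x z.
Proof. by move=> fxy eyz; apply: realizerP; exists y. Qed.

Lemma pairingP e f x y z : app (sval e) x y -> app (sval f) x z ->
  app (sval (pairing e f)) x (pair y z).
Proof. by move=> exy fxz; apply: realizerP; exists y, z. Qed.

Definition closure_of (e : computable_elt) : N -> N :=
  projT1 (cid (eff_curry NE (svalP e))).

Lemma closure_of_tracked e : tracked (fun x y => y = closure_of e x).
Proof. exact: (projT2 (cid (eff_curry NE (svalP e)))).1. Qed.

Lemma closure_of_app e x y z :
  app (sval e) (pair x y) z -> app (closure_of e x) y z.
Proof. exact: (projT2 (cid (eff_curry NE (svalP e)))).2. Qed.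

Definition constant (e : computable_elt) : computable_elt :=
  realizer (eff_const NE (svalP e)).
Definition tag_elt (b : bool) : computable_elt := exist _ _ (eff_tag NE b).
(** Currying puts the environment before the argument, whereas index 0 is the head of the
    environment. *)
Definition swap : computable_elt :=
  pairing (realizer (eff_snd NE)) (realizer (eff_fst NE)).

(* [compile t] is a realizer of the function sending <x_0, <x_1, ...>> to the value
   of [t] at x_0, x_1, ... (de Bruijn indices). *)
Fixpoint compile (t : term) : computable_elt :=
  match t with
  | Var n => iter n (fun e => compose e (realizer (eff_snd NE)))
                    (realizer (eff_fst NE))
  | Cst e => constant e
  | App t u => compose (realizer (eff_eval NE)) (pairing (compile t) (compile u))
  | Pr t u => pairing (compile t) (compile u)
  | Fs t => compose (realizer (eff_fst NE)) (compile t)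
  | Sn t => compose (realizer (eff_snd NE)) (compile t)
  | If t u v => compose (realizer (eff_cond NE))
                  (pairing (compile t) (pairing (compile u) (compile v)))
  | Lam t => realizer (closure_of_tracked (compose (compile t) swap))
  | Closed t => compose (compile t) (constant (tag_elt false))
  end.

Definition den (t : term) (r v : N) : Prop := app (sval (compile t)) r v.

Definition clo (t : term) (r : N) : N := closure_of (compose (compile t) swap) r.

Lemma clo_app t r x v : den t (pair x r) v -> app (clo t r) x v.
Proof.
move=> tv; apply: closure_of_app; apply: composeP tv.
by apply: pairingP; apply: realizerP; [exists r | exists x].
Qed.

Lemma den_var0 x r : den (Var 0) (pair x r) x.
Proof. by apply: realizerP; exists r. Qed.

Lemma den_varS n x r v : den (Var n) r v -> den (Var n.+1) (pair x r) v.
Proof.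
move=> nv; apply: (@composeP _ _ _ r); last exact: nv.
by apply: realizerP; exists x.
Qed.

Lemma den_cst e r : den (Cst e) r (sval e).
Proof. exact: realizerP. Qed.

Lemma den_app t u r f x v : den t r f -> den u r x -> app f x v -> den (App t u) r v.
Proof.
move=> tf ux fxv; apply: (@composeP _ _ _ (pair f x)); first exact: pairingP.
by apply: realizerP; exists f, x.
Qed.

Lemma den_pr t u r x y : den t r x -> den u r y -> den (Pr t u) r (pair x y).
Proof. exact: pairingP. Qed.

Lemma den_fs t r x y : den t r (pair x y) -> den (Fs t) r x.
Proof. by move=> txy; apply: composeP txy _; apply: realizerP; exists y. Qed.

Lemma den_sn t r x y : den t r (pair x y) -> den (Sn t) r y.
Proof. by move=> txy; apply: composeP txy _; apply: realizerP; exists x. Qed.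

Lemma den_true t u v r x y :
  den t r (tag N true) -> den u r x -> den v r y -> den (If t u v) r x.
Proof.
move=> tb ux vy; apply: composeP (pairingP tb (pairingP ux vy)) _.
by apply: realizerP; exists true, x, y.
Qed.

Lemma den_false t u v r x y :
  den t r (tag N false) -> den u r x -> den v r y -> den (If t u v) r y.
Proof.
move=> tb ux vy; apply: composeP (pairingP tb (pairingP ux vy)) _.
by apply: realizerP; exists false, x, y.
Qed.

Lemma den_lam t r : den (Lam t) r (clo t r).
Proof. exact: realizerP. Qed.

Lemma den_closed t r v : den t (tag N false) v -> den (Closed t) r v.
Proof. by move=> tv; apply: composeP tv; apply: realizerP. Qed.

(* Recursion by self-application: in the body, with argument [Var 0], the function
   itself is [App (Var 1) (Var 1)]. *)
Definition Rec (t : term) : term := App (Lam (Lam t)) (Lam (Lam t)).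
Definition recur (t : term) (r : N) : N := clo t (pair (clo (Lam t) r) r).

Lemma recur_app t r : app (clo (Lam t) r) (clo (Lam t) r) (recur t r).
Proof. exact: clo_app (den_lam _ _). Qed.

Lemma den_rec t r : den (Rec t) r (recur t r).
Proof. exact: den_app (den_lam _ _) (den_lam _ _) (recur_app _ _). Qed.

Lemma realize t : exists e, comp e /\
  forall x v, den t (pair x (tag N false)) v -> app e x v.
Proof.
pose e := compose (compile t) (pairing (realizer (eff_id NE)) (constant (tag_elt false))).
exists (sval e); split=> [|x v tv]; first exact: svalP.
by apply: composeP tv; apply: pairingP; apply: realizerP.
Qed.

Definition Tag (b : bool) : term := Cst (tag_elt b).

Lemma den_tag b r : den (Tag b) r (tag N b).
Proof. exact: (@den_cst (tag_elt b)). Qed.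

End Terms.

Arguments Var {N} n.
Opaque den clo.

(** Evaluates terms by unification. Conditionals are left out: their branch is chosen by hand with
    [den_true] or [den_false]. *)
Ltac den_step :=
  match goal with
  | |- den _ ?t _ _ => is_var t; unfold t
  | |- den _ (Var 0) _ _ => eapply den_var0
  | |- den _ (Var _) _ _ => eapply den_varS
  | |- den _ (Tag _ _) _ _ => eapply den_tag
  | |- den _ (Cst _) _ _ => eapply den_cst
  | |- den _ (Rec _) _ _ => eapply den_rec
  | |- den _ (App _ _) _ _ => eapply den_app
  | |- den _ (Pr _ _) _ _ => eapply den_pr
  | |- den _ (Fs _) _ _ => eapply den_fs
  | |- den _ (Sn _) _ _ => eapply den_sn
  | |- den _ (Lam _) _ _ => eapply den_lam
  | |- den _ (Closed _) _ _ => eapply den_closed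
  | |- app _ _ _ => eassumption
  | |- app ?t _ _ => is_var t; unfold t
  | |- app (recur _ _ _) _ _ => eapply clo_app
  | |- app (clo _ _ _) (clo _ _ _) _ => eapply recur_app
  | |- app (clo _ _ _) _ _ => eapply clo_app
  end.
Ltac den_tac := repeat den_step.

(** * The topology generated by a multimap *)

Section Generated.
Context (N : algebra) (NE : effective N).

(* Winning positions of the Computer in the game with queries to [g], coded as
   well-founded trees: <halt, <v, _>>, or <query, <q, k>> where [k] maps every
   answer of the Oracle to a winning position. *)
Inductive generated (g : multimap N) (p : set N) : N -> Prop :=
| generated_halt v k of p v : generated g p (pair (tag N true) (pair v k))
| generated_step q k r (h : N -> N) of g q = Some r
    & (forall z, r z -> app k z (h z)) & (forall z, r z -> generated g p (h z)) :
    generated g p (pair (tag N false) (pair q k)).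

(** The constructor carries the function [h] so that its premise is directly recursive; choice
    supplies it from [impl]. *)
Lemma generated_query (g : multimap N) p q k r : g q = Some r ->
  impl r (generated g p) k -> generated g p (pair (tag N false) (pair q k)).
Proof.
move=> gq kr.
have /choice [h hP] : forall z, exists y, r z -> app k z y /\ generated g p y.
  move=> z; have [/kr [y ky]|nz] := pselect (r z); last by exists z.
  by exists y.
by apply: (generated_step gq (h := h)) => z /hP [].
Qed.

Lemma generated_haltE g p v k :
  generated g p (pair (tag N true) (pair v k)) -> p v.
Proof.
move E: (pair _ _) => x px; case: px E => [v' k' pv|q k' r h _ _ _] /(pair_inj NE) [].
  by move=> _ /(pair_inj NE) [->].
by move/(tag_inj NE).
Qed.

Lemma generated_queryE g p q k :
  generated g p (pair (tag N false) (pair q k)) ->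
  exists2 r, g q = Some r & impl r (generated g p) k.
Proof.
move E: (pair _ _) => x px; case: px E => [v' k' pv|q' k' r h gq kh hp] /(pair_inj NE) [].
  by move/(tag_inj NE).
move=> _ /(pair_inj NE) [-> ->]; exists r => // z rz.
by exists (h z); split; [exact: kh | exact: hp].
Qed.

Lemma generated_sub g p q : p `<=` q -> generated g p `<=` generated g q.
Proof.
move=> pq x; elim=> [v k /pq|a k r h ga kh _ IH]; first exact: generated_halt.
exact: generated_step ga kh IH.
Qed.

(** The induction follows membership for one index [i0]. For any other index, inversion gives the
    same node, and single-valued application gives the same successors. *)
Lemma generated_cap g : preserves_intersections (generated g).
Proof.
move=> I D p [i0 Di0]; apply/seteqP; split=> [x px i Di|x px].
  by apply: generated_sub px => y; apply.
have := px _ Di0 => px0; elim: px0 px => [v k _|q k r h gq kh _ IH] px.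
  by apply: generated_halt => i /px /generated_haltE.
apply: (generated_step gq kh) => z rz; apply: IH => // i /px.
move=> /generated_queryE [r' + kr]; rewrite gq => -[E]; rewrite -E in kr.
by have [y [/(app_fun (kh z rz)) <-]] := kr z rz.
Qed.

(** Iteration over trees, uniform in [g], [p] and [q]: [h] treats the leaves, and [a] the queries
    whose continuation already yields results in [q]. *)
Lemma generated_fold : exists e : N, comp e /\ forall h a, exists f,
  app e (pair h a) f /\ forall g p q,
    impl p q h ->
    (forall x r k, g x = Some r -> impl r q k ->
       exists y, app a (pair x k) y /\ q y) ->
    impl (generated g p) q f.
Proof.
(* Both branches are delayed by [Lam], and the chosen one is forced by a dummy argument. *)
pose body : term N := App (If (Fs (Var 0))
    (Lam (App (Fs (Var 3)) (Fs (Sn (Var 1)))))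
    (Lam (App (Sn (Var 3)) (Pr (Fs (Sn (Var 1)))
       (Lam (App (App (Var 3) (Var 3)) (App (Sn (Sn (Var 2))) (Var 0))))))))
  (Tag NE true).
have [e [ce eP]] := realize NE (Rec body).
exists e; split=> // h a.
pose env := pair (pair h a) (tag N false).
exists (recur NE body env).
split=> [|g p q hpq apq x]; first by apply: eP; den_tac.
elim=> [v k /hpq [y [hy qy]]|x' k r k' gx kk' _ IH].
  exists y; split=> //; den_tac; first by eapply den_true; den_tac.
  by den_tac.
pose c := clo NE (App (App (Var 3) (Var 3)) (App (Sn (Sn (Var 2))) (Var 0)))
  (pair (tag N true) (pair (pair (tag N false) (pair x' k))
     (pair (clo NE (Lam body) env) env))).
have [|y [ay qy]] := apq x' r c gx.
  move=> z rz; have [y [fy qy]] := IH z rz; have kz := kk' z rz.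
  by exists y; split=> //; den_tac.
exists y; split=> //; den_tac; first by eapply den_false; den_tac.
by den_tac.
Qed.

Definition elt_of (e : N) (ce : comp e) : computable_elt N := exist _ e ce.

Lemma generated_monotone g : monotone (generated g).
Proof.
have [e [ce eP]] := generated_fold.
have [m [cm mP]] := realize NE (App (Cst (elt_of ce))
  (Pr (Lam (Pr (Tag NE true) (Pr (App (Var 1) (Var 0)) (Var 0))))
      (Lam (Pr (Tag NE false) (Var 0))))).
exists m; split=> // p q h hpq.
set t := Pr (Tag NE true) _ in mP; set u := Pr (Tag NE false) _ in mP.
pose env := pair h (tag N false).
have [f [ef fP]] := eP (clo NE t env) (clo NE u env).
exists f; split; first by apply: mP; den_tac.
apply: fP => [v /hpq [y [hv qy]]|x r k gx kr].
  exists (pair (tag N true) (pair y v)); split; last exact: generated_halt.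
  by den_tac.
exists (pair (tag N false) (pair x k)); split; first by den_tac.
exact: generated_query gx kr.
Qed.

Lemma generated_inflationary g : inflationary (generated g).
Proof.
have [e [ce eP]] := realize NE (Pr (Tag NE true) (Pr (Var 0) (Var 0))).
exists e; split=> // p v pv; exists (pair (tag N true) (pair v v)).
by split; [apply: eP; den_tac | exact: generated_halt].
Qed.

(** The fold grafts: each leaf is replaced by the tree that it carries. *)
Lemma generated_idempotent g : idempotent_op (generated g).
Proof.
have [e [ce eP]] := generated_fold.
have [m [cm mP]] := realize NE (App (App (Cst (elt_of ce))
  (Pr (Lam (Var 0)) (Lam (Pr (Tag NE false) (Var 0))))) (Var 0)).
exists m; split=> // p x px.
set t := Var 0 in mP; set u := Pr (Tag NE false) _ in mP.
pose env := pair x (tag N false).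
have [f [ef fP]] := eP (clo NE t env) (clo NE u env).
have [||y [fx py]] := fP g (generated g p) (generated g p) _ _ x px.
- by move=> y py; exists y; split=> //; den_tac.
- move=> x' r k gx kr; exists (pair (tag N false) (pair x' k)).
  by split; [den_tac | exact: generated_query gx kr].
by exists y; split=> //; apply: mP; den_tac.
Qed.

Lemma generated_topology g : LT_topology (generated g).
Proof.
split; [exact: generated_monotone | exact: generated_inflationary|].
exact: generated_idempotent.
Qed.

Lemma generated_single : exists e : N, comp e /\ forall x, exists2 y, app e x y &
  forall g p r, g x = Some r -> r `<=` p -> generated g p y.
Proof.
have [e [ce eP]] := realize NE (Pr (Tag NE false)
  (Pr (Var 0) (Lam (Pr (Tag NE true) (Pr (Var 0) (Var 0)))))).
exists e; split=> // x; eexists; first by apply: eP; den_tac.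
move=> g p r gx rp; apply: (generated_query gx) => z /rp pz.
by eexists; split; [den_tac | exact: generated_halt].
Qed.

Definition realizes_into (f : multimap N) (j : set N -> set N) : Prop :=
  exists e : N, comp e /\
    forall x r, f x = Some r -> exists y, app e x y /\ j r y.

(** Forward, [e] is applied to the tree that asks [x] once and halts with the answer. Backward,
    trees are folded into [j]: leaves by inflation, queries by monotonicity along the continuation
    followed by idempotence. *)
Lemma generated_le f j : LT_topology j -> le_r (generated f) j <-> realizes_into f j.
Proof.
move=> [[m [cm mP]] [i [ci iP]] [d [cd dP]]]; split.
  move=> [e [ce eP]]; have [s [cs sP]] := generated_single.
  have [t [ct tP]] := realize NE (App (Cst (elt_of ce)) (App (Cst (elt_of cs)) (Var 0))).
  exists t; split=> // x r fx; have [y sy yP] := sP x.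
  have [z [yz rz]] := eP r y (yP f r r fx (fun _ H => H)).
  by exists z; split=> //; apply: tP; den_tac.
move=> [e [ce eP]]; have [l [cl lP]] := generated_fold.
have [t [ct tP]] := realize NE (App (App (Cst (elt_of cl)) (Pr (Cst (elt_of ci))
   (Lam (App (Cst (elt_of cd)) (App (App (Cst (elt_of cm)) (Sn (Var 0)))
      (App (Cst (elt_of ce)) (Fs (Var 0)))))))) (Var 0)).
exists t; split=> // p x px.
set u := App (Cst (elt_of cd)) _ in tP.
have [h [lh hP]] := lP i (clo NE u (pair x (tag N false))).
have [||y [hy jy]] := hP f p (j p) _ _ x px.
- exact: iP.
- move=> q r k fq kr; have [a [ea ja]] := eP q r fq.
  have [b [mb bP]] := mP r (j p) k kr.
  have [c [bc jc]] := bP a ja; have [y [dy jy]] := dP p c jc.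
  by exists y; split=> //; den_tac.
by exists y; split=> //; apply: tP; den_tac.
Qed.

Lemma generated_surj j : LT_topology j -> preserves_intersections j ->
  exists g, le_r (generated g) j /\ le_r j (generated g).
Proof.
move=> LTj capj.
pose g x := if pselect (exists p, j p x) then
  Some (\bigcap_(p in [set p | j p x]) p) else None.
exists g; split.
  apply/(generated_le _ LTj); have [e ce eP] := eff_id NE.
  exists e; split=> // x r; rewrite /g; case: pselect => // -[p jp] [<-].
  exists x; split; first exact: eP.
  (* The family is nonempty where [g] is defined, so preservation of intersections puts [x] in [j]
     of [g x]. *)
  by rewrite (capj _ _ id); [move=> q | exists p].
have [e [ce eP]] := generated_single; exists e; split=> // p x px.
have [y exy yP] := eP x; exists y; split=> //.
have gx : g x = Some (\bigcap_(p in [set p | j p x]) p).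
  by rewrite /g; case: pselect => // -[]; exists p.
by apply: (yP _ _ _ gx) => z; apply.
Qed.

End Generated.

(** * Strategies *)

Section Strategies.
Context (N : algebra) (NE : effective N).
Implicit Types (f g : multimap N) (tau : strategy N).

(* [p] is the value of [f] at the first move of the Oracle. *)
Inductive wins (p : set N) g tau (s : seq N) : Prop :=
| wins_halt v of tau s = Some (Halt, v) & p v
| wins_query q r of tau s = Some (Query, q) & g q = Some r &
    (forall z, r z -> wins p g tau (rcons s z)).

(** From a position that is not inductively winning, the Oracle can answer any legal query so as to
    stay in such positions. Choice turns these answers into a play that the Computer does not
    win. *)
Lemma winning_wins f g tau x r :
  winning f g tau -> f x = Some r -> wins r g tau [:: x].
Proof.
move=> wtau fx; apply: contrapT => nw.
pose good s z := exists q r', [/\ tau s = Some (Query, q), g q = Some r', r' z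
  & ~ wins r g tau (rcons s z)].
have /choice [next nextP] : forall s, exists z, (exists z', good s z') -> good s z.
  move=> s; have [[z zs]|n] := pselect (exists z', good s z'); first by exists z.
  by exists x.
pose hist n := iter n (fun s => rcons s (next s)) [:: x].
pose z n := last x (hist n).
have mk n : mkseq z n.+1 = hist n.
  elim: n => // n IHn; rewrite /mkseq -addn1 iotaD map_cat -/(mkseq z n.+1) IHn.
  by rewrite /= add0n cats1 /z /= last_rcons.
have [n [lt_n end_n]] := wtau z.
have nwin m : m <= n -> ~ wins r g tau (hist m) /\ oracle_legal f g tau z m.
  elim: m => [|m IHm] mn; first by split=> //; exists r.
  have [nwm _] := IHm (ltnW mn).
  have [_ [q [tq [r' gq]]]] := lt_n m mn.
  have [|q' [r'' [tq' gq' rz nws]]] := nextP (hist m).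
    apply: contrapT => ng; apply: nwm; rewrite /computer_move mk in tq.
    apply: (wins_query tq gq) => y ry; apply: contrapT => nwy; apply: ng.
    by exists y, q, r'.
  split=> //; exists q'; rewrite /computer_move mk; split=> //.
  by exists r''; rewrite /z /= last_rcons.
have [nwn leg] := nwin n (leqnn n).
case: end_n => [|[_ [v [tv [r' [fr' rv]]]]]] //.
apply: nwn; move: tv; rewrite /computer_move mk => tv; apply: (wins_halt _ tv).
by move: fr'; rewrite fx => -[->].
Qed.

Definition tracks (h : N) tau (s : seq N) : Prop :=
  forall t m, tau (s ++ t) = Some m -> app h (seq_code t) (move_code m).

(* The recursive function sending [h] to the element of [generated] describing the
   strategy that answers to the history [t] with [h * t]. *)
Definition resume_body : term N :=
  let m := App (Var 0) (Pr (Tag NE false) (Tag NE false)) in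
  Pr (Fs m) (Pr (Sn m) (Lam (App (App (Var 2) (Var 2))
    (Lam (App (Var 2) (Pr (Tag NE true) (Pr (Var 1) (Var 0)))))))).

(** The value of [h] at the empty history is the current move, whose tag already is that of a tree
    node. *)
Lemma wins_generated p g tau s h : wins p g tau s -> tracks h tau s ->
  exists y, app (recur NE resume_body (tag N false)) h y /\ generated g p y.
Proof.
move=> w; elim: w h => {s} [s v tv pv|s q r tq gq _ IH] h trk.
  have := trk [::] _; rewrite cats0 => /(_ _ tv) /= hv; rewrite /move_code /= in hv.
  by eexists; split; [rewrite /resume_body; den_tac | exact: generated_halt].
have := trk [::] _; rewrite cats0 => /(_ _ tq) /= hq; rewrite /move_code /= in hq.
eexists; split; first by rewrite /resume_body; den_tac.
apply: (generated_query gq) => z rz.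
set env := pair h _.
(* [h'] answers a history [t] as [h] answers [z :: t]. *)
pose h' := clo NE (App (Var 2) (Pr (Tag NE true) (Pr (Var 1) (Var 0)))) (pair z env).
have [|y [hy gy]] := IH z rz h'.
  move=> t m; rewrite cat_rcons => /trk /= ht.
  by rewrite /h' /env; den_tac.
by exists y; split=> //; rewrite /env; den_tac.
Qed.

Lemma le_TW_realizes f g : le_TW f g -> realizes_into f (generated g).
Proof.
move=> [tau [[e [ce eP]] wtau]].
have [t [ct tP]] := realize NE (App (Closed (Rec resume_body))
  (Lam (App (Cst (elt_of ce)) (Pr (Tag NE true) (Pr (Var 1) (Var 0)))))).
exists t; split=> // x r fx.
pose h := clo NE (App (Cst (elt_of ce)) (Pr (Tag NE true) (Pr (Var 1) (Var 0))))
  (pair x (tag N false)).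
have [|y [hy gy]] := wins_generated (winning_wins wtau fx) (h := h).
  by move=> s m /eP /= es; rewrite /h; den_tac.
by exists y; split=> //; apply: tP; den_tac.
Qed.

(* Plays the element [x] of [generated g p] against the answers listed in [t]. *)
Definition run_body : term N :=
  App (If (Fs (Sn (Var 0)))
    (Lam (App (App (Var 2) (Var 2))
       (Pr (App (Sn (Sn (Fs (Var 1)))) (Fs (Sn (Sn (Var 1)))))
           (Sn (Sn (Sn (Var 1)))))))
    (Lam (Pr (Fs (Fs (Var 1))) (Fs (Sn (Fs (Var 1)))))))
  (Tag NE true).

Definition run : N := recur NE run_body (tag N false).

Lemma run_nil b v k : app run (pair (pair (tag N b) (pair v k)) (seq_code [::]))
  (pair (tag N b) v).
Proof. by rewrite /run /run_body /=; den_tac; [eapply den_false|]; den_tac. Qed.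

Lemma run_cons b v k z y t m : app k z y -> app run (pair y (seq_code t)) m ->
  app run (pair (pair (tag N b) (pair v k)) (seq_code (z :: t))) m.
Proof.
move=> kz; rewrite /run /run_body /= => rt.
by den_tac; [eapply den_true|]; den_tac.
Qed.

(** Undefined where [e] diverges or does not yield the code of a move; injectivity of [move_code]
    makes the chosen move the only one. *)
Definition strategy_of (e : N) : strategy N := fun s =>
  if pselect (exists m, app e (seq_code s) (move_code m)) is left ex
  then Some (projT1 (cid ex)) else None.

Lemma move_code_inj : injective (@move_code N).
Proof.
move=> [a x] [b y] /(pair_inj NE) /= [/(tag_inj NE) ab ->].
by case: a b ab => -[].
Qed.

Lemma strategy_ofP e s m :
  strategy_of e s = Some m <-> app e (seq_code s) (move_code m).
Proof.
rewrite /strategy_of; case: pselect => [ex|nex]; last first.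
  by split=> // em; case: nex; exists m.
case: cid => m' /= em'; split=> [[<-] //|/(app_fun em') /move_code_inj -> //].
Qed.

(** Induction on the tree [y] reached at round [n]: a leaf is a correct halt, and after a query the
    Oracle either breaks the rules or moves the play to a subtree. *)
Lemma generated_computer_wins f g e z n r y :
  f (z 0) = Some r -> generated g r y ->
  (forall t m, app run (pair y (seq_code t)) m ->
     app e (seq_code (mkseq z n.+1 ++ t)) m) ->
  (forall m, m < n -> oracle_legal f g (strategy_of e) z m /\
     legal_query g (strategy_of e) z m) ->
  oracle_legal f g (strategy_of e) z n ->
  computer_wins f g (strategy_of e) z.
Proof.
move=> fz gy; elim: gy n => [v k rv|q k r' h gq kh _ IH] n trk lt_n leg.
  exists n; split=> //; right; split=> //; exists v; split; last by exists r.
  apply/strategy_ofP; rewrite -[mkseq _ _]cats0; apply: trk.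
  exact: run_nil.
have mv : computer_move (strategy_of e) z n = Some (Query, q).
  apply/strategy_ofP; rewrite -[mkseq _ _]cats0; apply: trk.
  exact: run_nil.
have lt_Sn m : m < n.+1 -> oracle_legal f g (strategy_of e) z m /\
    legal_query g (strategy_of e) z m.
  rewrite ltnS leq_eqVlt => /predU1P[->|/lt_n //]; split=> //.
  by exists q; split=> //; exists r'.
have [rz|nrz] := pselect (r' (z n.+1)).
  apply: (IH _ rz n.+1) => // [t m yt|]; last by exists q; split=> //; exists r'.
  rewrite /mkseq -addn1 iotaD map_cat -/(mkseq z n.+1) -catA add0n.
  by apply: trk; apply: run_cons yt; apply: kh.
exists n.+1; split=> //; left=> -[q' [mv' [r'' [gq' rz]]]].
by move: mv'; rewrite mv => -[qq']; move: gq'; rewrite -qq' gq => -[E]; rewrite E in nrz.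
Qed.

Lemma realizes_le_TW f g : realizes_into f (generated g) -> le_TW f g.
Proof.
move=> [e [ce eP]].
(* The first entry of the history is turned into a tree by [e], and the remaining entries are played
   against it. *)
have [t [ct tP]] := realize NE (App (Closed (Rec run_body))
  (Pr (App (Cst (elt_of ce)) (Fs (Sn (Var 0)))) (Sn (Sn (Var 0))))).
exists (strategy_of t); split; first by exists t; split=> // s m /strategy_ofP.
move=> z; have [[r fz]|nfz] := pselect (mdom f (z 0)); last first.
  by exists 0; split=> //; left.
have [y [ey gy]] := eP _ _ fz.
apply: (@generated_computer_wins _ _ _ _ 0 r y) => // [s m ym|]; last by exists r.
by rewrite /run in ym; apply: tP; rewrite /=; den_tac.
Qed.

Definition topology_of (f : multimap N) : cap_topology N :=
  exist _ (generated f) (conj (generated_topology NE f) (@generated_cap _ NE f)).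

Lemma le_TW_le_cap f g : le_TW f g <-> le_cap (topology_of f) (topology_of g).
Proof.
rewrite /le_cap /= (generated_le NE _ (generated_topology NE g)).
by split; [apply: le_TW_realizes | apply: realizes_le_TW].
Qed.

Lemma topology_of_surj (j : cap_topology N) :
  exists f, le_cap (topology_of f) j /\ le_cap j (topology_of f).
Proof. by case: j => j [LTj capj]; apply: (generated_surj NE). Qed.

Lemma le_cap_refl (j : cap_topology N) : le_cap j j.
Proof.
have [e ce eP] := eff_id NE; exists e; split=> // p x px.
by exists x; split=> //; apply: eP.
Qed.

Lemma le_cap_trans (j k l : cap_topology N) : le_cap j k -> le_cap k l -> le_cap j l.
Proof.
move=> [e [ce eP]] [d [cd dP]]; have [c cc cP] := eff_comp NE cd ce.
exists c; split=> // p x /eP [y [exy /dP [z [dyz lz]]]].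
by exists z; split=> //; apply: cP; exists y.
Qed.

End Strategies.

(** * Degrees *)

Definition preorder_degree (T : Type) (R : T -> T -> Prop) (a : T) : degree R :=
  exist _ [set b | R a b /\ R b a] (ex_intro _ a erefl).

Lemma preorder_degree_surj (T : Type) (R : T -> T -> Prop) (C : degree R) :
  exists a, C = preorder_degree R a.
Proof. by case: C => C [a Ca]; exists a; apply: eq_exist. Qed.

Section Order.
Context (T : Type) (R : T -> T -> Prop).
Hypotheses (Rxx : forall a, R a a) (Rtrans : forall b a c, R a b -> R b c -> R a c).

Lemma preorder_degree_le a b :
  degree_le (preorder_degree R a) (preorder_degree R b) <-> R a b.
Proof.
split=> [[a' [b' [[aa' _] [_ b'b] ab]]]|ab]; last by exists a, b.
exact: Rtrans aa' (Rtrans ab b'b).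
Qed.

Lemma preorder_degree_eq a b :
  preorder_degree R a = preorder_degree R b <-> R a b /\ R b a.
Proof.
split=> [E|[ab ba]].
  have : sval (preorder_degree R a) b by rewrite E.
  by [].
apply: eq_exist; apply/seteqP; split=> c [h1 h2]; split;
  by [apply: Rtrans h1 | apply: Rtrans h2 _].
Qed.

Lemma degree_order : Relation_Definitions.order _ (@degree_le T R).
Proof.
split=> [C|C D E|C D].
- by have [a ->] := preorder_degree_surj C; apply/preorder_degree_le.
- have [a ->] := preorder_degree_surj C; have [b ->] := preorder_degree_surj D.
  have [c ->] := preorder_degree_surj E.
  by move=> /preorder_degree_le ab /preorder_degree_le bc;
    apply/preorder_degree_le; apply: Rtrans bc.
- have [a ->] := preorder_degree_surj C; have [b ->] := preorder_degree_surj D.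
  by move=> /preorder_degree_le ab /preorder_degree_le ba; apply/preorder_degree_eq.
Qed.

End Order.

(** A map that preserves and reflects preorders and is surjective up to equivalence induces an
    isomorphism of degrees; its inverse uses chosen representatives and preimages. *)
Lemma isomorphic_degrees (T U : Type) (R : T -> T -> Prop) (S : U -> U -> Prop)
    (h : T -> U) :
  (forall a, S a a) -> (forall b a c, S a b -> S b c -> S a c) ->
  (forall a b, R a b <-> S (h a) (h b)) ->
  (forall b, exists a, S (h a) b /\ S b (h a)) ->
  isomorphic_posets (@degree_le T R) (@degree_le U S).
Proof.
move=> Sxx Strans hP hsurj.
have Rxx a : R a a by apply/hP.
have Rtrans b a c : R a b -> R b c -> R a c.
  by move=> /hP ab /hP bc; apply/hP; apply: Strans bc.
have /choice [rep repP] := @preorder_degree_surj T R.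
have /choice [repS repSP] := @preorder_degree_surj U S.
have /choice [inv invP] := hsurj.
split; [exact: degree_order | exact: degree_order|].
pose F C := preorder_degree S (h (rep C)).
have leF C D : degree_le C D <-> degree_le (F C) (F D).
  by rewrite {1}[C]repP {1}[D]repP !preorder_degree_le.
exists F; split=> //; exists (fun D => preorder_degree R (inv (repS D))) => [C|D].
  rewrite [RHS]repP; apply/(preorder_degree_eq Rxx Rtrans); rewrite !hP.
  set c := h (rep C); have /(preorder_degree_eq Sxx Strans) := repSP (F C).
  have [i1 i2] := invP (repS (F C)) => -[c1 c2].
  by split; [apply: Strans i1 c2 | apply: Strans c1 i2].
rewrite [RHS]repSP; apply/(preorder_degree_eq Sxx Strans).
set a := inv (repS D).
have /(preorder_degree_eq Rxx Rtrans) := repP (preorder_degree R a).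
rewrite !hP => -[c1 c2]; have [i1 i2] := invP (repS D).
by split; [apply: Strans c2 i1 | apply: Strans i2 c1].
Qed.

Theorem corollary3p17 (a : algebra_name) :
  isomorphic_posets
    (@degree_le (multimap (algebra_of a)) (@le_TW (algebra_of a)))
    (@degree_le (cap_topology (algebra_of a)) (@le_cap (algebra_of a))).
Proof.
have NE := algebra_effective a.
apply: (@isomorphic_degrees _ _ _ _ (topology_of NE)).
- exact: le_cap_refl.
- by move=> k j l; apply: le_cap_trans.
- exact: le_TW_le_cap.
- exact: topology_of_surj.
Qed.
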